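(* Let $n\ge 1$, let $C\in\mathbb{R}^{2^n\times 2^n}$ be a nonzero symmetric matrix with Pauli expansion $C=\sum_{i=1}^{M}c_{(x_i,z_i)}P_{(x_i,z_i)}$, where all $c_{(x_i,z_i)}\neq 0$, and let $\dot{\mathcal{D}}_C$ be the diagonal group of $C$ without the identity. Then for every $\epsilon\ge 0$, $$\mathrm{GW}(C,\dot{\mathcal{D}}_C,\epsilon)=\mathrm{GW}\bigl(C,2^{[n]}\setminus\{\varnothing\},\epsilon\bigr).$$
   Context: For $(x,z)\in\{0,1\}^{2n}$ let $P_{(x,z)}=\bigotimes_{j=1}^n i^{x_jz_j}X^{x_j}Z^{z_j}$ be the Pauli string, where $X,Z$ are the $2\times 2$ Pauli matrices. Every real symmetric $2^n\times 2^n$ matrix is uniquely a real linear combination of Pauli strings. For $A\subseteq[n]=\{1,\dots,n\}$ let $Z_A=P_{(0,z_A)}$, where $z_A$ is the indicator vector of $A$ (so $Z_\varnothing=I$). Diagonal group: $\mathcal{G}_C$ is the group generated under multiplication by the Pauli strings with nonzero coefficient in the expansion of $C$, and $\mathcal{D}_C$ is the set of strings $Z_A$ that lie, up to sign, in $\mathcal{G}_C$. Equivalently, $Z_A\in\mathcal{D}_C$ iff $(0,z_A)$ lies in the $\mathbb{F}_2$-linear span of the vectors $(x_i,z_i)$, $i=1,\dots,M$. Set $\dot{\mathcal{D}}_C=\mathcal{D}_C\setminus\{I\}$, identified with the set of nonempty $A\subseteq[n]$ with $Z_A\in\mathcal{D}_C$. Relaxed Goemans-Williamson value: for $S\subseteq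 2^{[n]}\setminus\{\varnothing\}$ and $\epsilon\ge0$, $\mathrm{GW}(C,S,\epsilon)$ is the maximum of $\operatorname{tr}\left[\frac{C}{\|C\|}\rho\right]$ over real symmetric $\rho\in\mathbb{R}^{2^n\times2^n}$ with $\rho\ge 0$ (positive semidefinite), $\operatorname{tr}[\rho]=1$, and $|\operatorname{tr}[Z_A\rho]|\le\epsilon$ for all $A\in S$. Here $\|C\|$ is the operator norm. *)

(* Defs.v *)
From HB Require Import structures.
From mathcomp Require Import all_boot all_order all_algebra.
From mathcomp Require Import all_classical all_reals all_analysis.
From mathcomp Require Import complex mxtens ring lra.

Set Implicit Arguments.
Unset Strict Implicit.
Unset Printing Implicit Defensive.

Import Order.TTheory GRing.Theory Num.Theory.
Import numFieldNormedType.Exports.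
Local Open Scope ring_scope.
Local Open Scope complex_scope.

Definition toC (R : realType) m n (A : 'M[R]_(m, n)) : 'M[R[i]]_(m, n) :=
  map_mx (real_complex R) A.

(* A 0 *t A 1 *t ... *t A n.-1; the cast is along 2 * 2 ^ n = 2 ^ n.+1. *)
Fixpoint bigtensmx (K : pzRingType) (n : nat) : ('I_n -> 'M[K]_2) -> 'M[K]_(2 ^ n) :=
  match n with
  | 0 => fun _ => 1%:M
  | n'.+1 => fun A =>
      castmx (esym (expnS 2 n'), esym (expnS 2 n'))
        (A ord0 *t bigtensmx (fun j => A (lift ord0 j)))
  end.

Definition pauliX (K : pzRingType) : 'M[K]_2 := \matrix_(i, j) (i != j)%:R.
Definition pauliZ (K : pzRingType) : 'M[K]_2 :=
  \matrix_(i, j) ((-1) ^+ i *+ (i == j)).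

(* A pair (x, z), standing for an element of {0,1}^(2n). *)
Definition pauli_index (n : nat) : finType :=
  ({ffun 'I_n -> bool} * {ffun 'I_n -> bool})%type.

Definition pauli (R : realType) (n : nat) (p : pauli_index n) : 'M[R[i]]_(2 ^ n) :=
  bigtensmx (fun j => 'i ^+ (p.1 j * p.2 j) *:
                      (pauliX R[i] ^+ p.1 j *m pauliZ R[i] ^+ p.2 j)).

Definition Zindex (n : nat) (A : {set 'I_n}) : pauli_index n :=
  ([ffun=> false], [ffun j => j \in A]).

Definition Zstr (R : realType) (n : nat) (A : {set 'I_n}) : 'M[R[i]]_(2 ^ n) :=
  pauli R (Zindex A).

Definition pauli_expansion (R : realType) (n : nat) (C : 'M[R]_(2 ^ n))
    (c : pauli_index n -> R) : Prop :=
  toC C = \sum_(p : pauli_index n) (c p)%:C *: pauli R p.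

(* There is at most one such c: see pauli_expansion_uniq. *)
Definition pauli_support (R : realType) (n : nat) (C : 'M[R]_(2 ^ n)) :
    set (pauli_index n) :=
  [set p | exists2 c, pauli_expansion C c & c p != 0]%classic.

Inductive generated_mx_group (K : comUnitRingType) (m : nat) (S : set 'M[K]_m) :
    'M[K]_m -> Prop :=
  | gen_mx_in A of S A : generated_mx_group S A
  | gen_mx_1 : generated_mx_group S 1%:M
  | gen_mx_mul A B of generated_mx_group S A & generated_mx_group S B :
      generated_mx_group S (A *m B)
  | gen_mx_inv A of generated_mx_group S A : generated_mx_group S (invmx A).

Definition pauli_group_of (R : realType) (n : nat) (C : 'M[R]_(2 ^ n)) :
    set 'M[R[i]]_(2 ^ n) :=
  [set Q | generated_mx_group (@pauli R n @` pauli_support C) Q]%classic.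

Definition diagonal_group (R : realType) (n : nat) (C : 'M[R]_(2 ^ n)) :
    set {set 'I_n} :=
  [set A | pauli_group_of C (Zstr R A) \/ pauli_group_of C (- Zstr R A)]%classic.

Definition nonempty_subsets (n : nat) : set {set 'I_n} :=
  [set A | A != finset.set0]%classic.

Definition diagonal_group_dot (R : realType) (n : nat) (C : 'M[R]_(2 ^ n)) :
    set {set 'I_n} :=
  (diagonal_group C `&` @nonempty_subsets n)%classic.

Definition l2norm (R : realType) m (v : 'cV[R]_m) : R :=
  Num.sqrt (\sum_i v i 0 ^+ 2).

Definition opnorm (R : realType) m (C : 'M[R]_m) : R :=
  sup [set l2norm (C *m v) | v in [set v : 'cV[R]_m | l2norm v = 1]]%classic.

Definition psdmx (R : realType) m (rho : 'M[R]_m) : Prop :=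
  forall v : 'cV[R]_m, 0 <= (v^T *m rho *m v) 0 0.

Definition GW_feasible (R : realType) (n : nat) (S : set {set 'I_n}) (eps : R) :
    set 'M[R]_(2 ^ n) :=
  [set rho | [/\ rho^T = rho, psdmx rho, \tr rho = 1 &
    forall A : {set 'I_n}, S A -> `|\tr (Zstr R A *m toC rho)| <= eps%:C]]%classic.

Definition GW_objective (R : realType) (n : nat) (C rho : 'M[R]_(2 ^ n)) : R :=
  \tr (((opnorm C)^-1 *: C) *m rho).

(* The supremum is attained when 0 <= eps and set0 is not in S: see GW_max. *)
Definition GW (R : realType) (n : nat) (C : 'M[R]_(2 ^ n))
    (S : set {set 'I_n}) (eps : R) : R :=
  sup [set GW_objective C rho | rho in GW_feasible S eps]%classic.

Lemma mxtrace_tens (K : pzRingType) m n (A : 'M[K]_m) (B : 'M[K]_n) :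
  \tr (A *t B) = \tr A * \tr B.
Proof. by rewrite /mxtrace mulr_sum; apply: eq_bigr => i _; rewrite mxE. Qed.

Lemma mxtrace_bigtens (K : comPzRingType) n (A : 'I_n -> 'M[K]_2) :
  \tr (bigtensmx A) = \prod_j \tr (A j).
Proof.
elim: n A => [|n IH] A; first by rewrite big_ord0 /= mxtrace1 expn0.
rewrite big_ord_recl -IH -mxtrace_tens /=.
by case: _ / (esym _) => //.
Qed.

Lemma mxtrace_Zstr (R : realType) n (A : {set 'I_n}) :
  A != finset.set0 -> \tr (Zstr R A) = 0.
Proof.
case/finset.set0Pn => j jA; rewrite mxtrace_bigtens (bigD1 j) //=.
rewrite !ffunE jA /= mul0n !expr0 expr1 mul1mx scale1r.
by rewrite /mxtrace !big_ord_recl big_ord0 !mxE /= !mulr1n expr0 expr1 addr0 subrr mul0r.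
Qed.

Lemma bigtensmx_mul (K : comPzRingType) n (A B : 'I_n -> 'M[K]_2) :
  bigtensmx A *m bigtensmx B = bigtensmx (fun j => A j *m B j).
Proof.
elim: n A B => [|n IH] A B /=; first by rewrite mulmx1.
rewrite -IH -tensmx_mul.
by case: _ / (esym _).
Qed.

Lemma mxtrace_pauli1_mul (K : comPzRingType) (a b c d : bool) (i : K) :
  i ^+ 2 = -1 ->
  \tr ((i ^+ (a * b) *: (pauliX K ^+ a *m pauliZ K ^+ b)) *m
       (i ^+ (c * d) *: (pauliX K ^+ c *m pauliZ K ^+ d)))
  = ((a == c) && (b == d))%:R *+ 2.
Proof.
move=> i2; rewrite -scalemxAl -scalemxAr scalerA mxtraceZ.
have -> : \tr ((pauliX K ^+ a *m pauliZ K ^+ b) *m (pauliX K ^+ c *m pauliZ K ^+ d))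
   = (-1) ^+ (b * c) * ((a == c) && (b == d))%:R *+ 2.
  have e1 (M N : 'M[K]_2) i0 j0 : (M *m N) i0 j0 = M i0 0 * N 0 j0 + M i0 1 * N 1 j0.
    rewrite mxE !big_ord_recl big_ord0 addr0.
    by congr (_ * _ + M _ _ * N _ _); apply: val_inj.
  have -> (M : 'M[K]_2) : \tr M = M 0 0 + M 1 1.
    rewrite /mxtrace !big_ord_recl big_ord0 addr0.
    by congr (_ + M _ _); apply: val_inj.
  by case: a b c d => [] [] [] []; rewrite !(expr0, expr1) !e1 !mxE /=; ring.
case: a b c d => [] [] [] [] /=;
  rewrite ?(muln0, mul0n, muln1, expr0, expr1, mul1r, mulr0, mulr0n, mul0rn) //.
by rewrite -expr2 i2 -mulrnAr mulrA mulrNN !mul1r.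
Qed.

Lemma mxtrace_pauli_mul (R : realType) n (p q : pauli_index n) :
  \tr (pauli R p *m pauli R q) = (p == q)%:R *+ 2 ^ n.
Proof.
rewrite bigtensmx_mul mxtrace_bigtens.
under eq_bigr do rewrite mxtrace_pauli1_mul ?sqr_i //.
case: eqP => [->|/eqP pq].
  under eq_bigr do rewrite !eqxx.
  by rewrite prodr_const card_ord natrX.
suff [j /negPf hj] : exists j, ~~ ((p.1 j == q.1 j) && (p.2 j == q.2 j)).
  by rewrite (bigD1 j) //= hj mul0rn mul0r mul0rn.
apply/existsP; rewrite -negb_forall; apply: contra pq => /forallP h.
case: p q h => [x z] [x' z'] /= h; apply/eqP; congr (_, _);
  by apply/ffunP => j; have /andP[/eqP h1 /eqP h2] := h j.
Qed.

Lemma pauli_expansion_uniq (R : realType) n (C : 'M[R]_(2 ^ n))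
    (c c' : pauli_index n -> R) :
  pauli_expansion C c -> pauli_expansion C c' -> c =1 c'.
Proof.
have cE (d : pauli_index n -> R) p : pauli_expansion C d ->
    \tr (toC C *m pauli R p) = (d p)%:C *+ 2 ^ n.
  move=> ->; rewrite mulmx_suml raddf_sum /= (bigD1 p) //= big1 ?addr0.
    by rewrite -scalemxAl mxtraceZ mxtrace_pauli_mul eqxx mulrnAr mulr1.
  move=> q /negPf qp.
  by rewrite -scalemxAl mxtraceZ mxtrace_pauli_mul qp mul0rn mulr0.
move=> ec ec' p; have := cE c p ec; rewrite (cE c' p ec') => /eqP.
rewrite -[eqbLHS]mulr_natr -[eqbRHS]mulr_natr.
have N0 : (2 ^ n)%:R != 0 :> R[i] by rewrite pnatr_eq0 -lt0n expn_gt0.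
by move=> /eqP/(mulIf N0) [].
Qed.

Lemma linear_functional_continuous (R : realType) m n (g : 'M[R]_(m, n) -> R) :
  (forall a A B, g (a *: A + B) = a * g A + g B) -> continuous g.
Proof.
move=> gl.
have g0 : g 0 = 0.
  by have := gl 1 0 0; rewrite scaler0 addr0 mul1r => /esym/eqP; rewrite -subr_eq0 addrK => /eqP.
have gD A B : g (A + B) = g A + g B by have := gl 1 A B; rewrite scale1r mul1r.
have gZ a A : g (a *: A) = a * g A by have := gl a A 0; rewrite !addr0 g0 addr0.
have gE A : g A = \sum_i \sum_j A i j * g (delta_mx i j).
  rewrite {1}[A]matrix_sum_delta (big_morph g gD g0); apply: eq_bigr => i _.
  by rewrite (big_morph g gD g0); apply: eq_bigr => j _; rewrite gZ.
rewrite (_ : g = fun A => \sum_i \sum_j A i j * g (delta_mx i j)); last exact/funext.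
apply: continuous_big => [|i _]; first exact: add_continuous.
apply: continuous_big => [|j _]; first exact: add_continuous.
move=> A; apply: continuousM; last exact: cst_continuous.
exact: coord_continuous.
Qed.

Lemma compact_unit_box (R : realType) m n :
  compact [set A : 'M[R]_(m, n) | forall i j, `|A i j| <= 1]%classic.
Proof.
have cv : continuous (vec_mx : 'rV[R]_(m * n) -> 'M[R]_(m, n)).
  move=> w s /nbhs_ballP[e e0 es]; apply/nbhs_ballP; exists e => // v wv.
  by apply: es; move: wv => [wv0 wv]; split=> // i j; rewrite !mxE; exact: wv.
pose B := [set w : 'rV[R]_(m * n) | forall k, `[(-1), 1]%classic (w ord0 k)]%classic.
have cB : compact B.
  apply: (@rV_compact R (m * n) (fun=> `[(-1 : R), 1]%classic)) => _.
  exact: segment_compact.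
have := continuous_compact (continuous_subspaceT cv) cB; congr compact.
apply/seteqP; split => [_ [w Bw <-] i j|A hA] /=.
  by rewrite mxE ler_norml; have := Bw (mxvec_index i j); rewrite /= in_itv.
exists (mxvec A); last exact: mxvecK.
move=> k; case/mxvec_indexP: k => i j /=; rewrite mxvecE in_itv /= -ler_norml; exact: hA.
Qed.

Lemma psdmx_unit_box (R : realType) m (rho : 'M[R]_m) :
  rho^T = rho -> psdmx rho -> \tr rho = 1 -> forall i j, `|rho i j| <= 1.
Proof.
move=> sym psd tr1.
have mD (A B : 'M[R]_1) : (A + B) 0 0 = A 0 0 + B 0 0 by rewrite mxE.
have mZ a (A : 'M[R]_1) : (a *: A) 0 0 = a * A 0 0 by rewrite mxE.
have qD a (e f : 'cV[R]_m) : ((e + a *: f)^T *m rho *m (e + a *: f)) 0 0 =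
    (e^T *m rho *m e) 0 0 + a * (e^T *m rho *m f) 0 0
    + (a * (f^T *m rho *m e) 0 0 + a * (a * (f^T *m rho *m f) 0 0)).
  have -> : (e + a *: f)^T = e^T + a *: f^T by apply/matrixP => i j; rewrite !mxE.
  rewrite !(mulmxDl, mulmxDr) -!(scalemxAl, scalemxAr).
  by rewrite !(mD, mZ); ring.
have dE i j : ((delta_mx i 0 : 'cV[R]_m)^T *m rho *m (delta_mx j 0 : 'cV[R]_m)) 0 0 = rho i j.
  by rewrite trmx_delta -rowE -colE !mxE.
have dge0 i : 0 <= rho i i by rewrite -dE; exact: psd.
have symE i j : rho j i = rho i j by rewrite -[in LHS]sym mxE.
have ple (a : R) i j : 0 <= rho i i + a * rho i j *+ 2 + a ^+ 2 * rho j j.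
  have := psd (delta_mx i 0 + a *: delta_mx j 0); rewrite qD !dE symE => h.
  by apply: le_trans h _; lra.
have dle1 i : rho i i <= 1.
  by rewrite -tr1 /mxtrace (bigD1 i) //= lerDl sumr_ge0.
move=> i j; rewrite ler_norml.
have := ple 1 i j; have := ple (-1) i j; have := dle1 i; have := dle1 j.
rewrite expr1n sqrrN expr1n !mul1r mulN1r.
by move=> h1 h2 h3 h4; apply/andP; split; lra.
Qed.

Lemma GW_feasible_compact (R : realType) n (S : set {set 'I_n}) (eps : R) :
  compact (GW_feasible S eps).
Proof.
apply: (subclosed_compact _ (@compact_unit_box R (2 ^ n) (2 ^ n))); last first.
  by move=> rho [sym psd tr1 _]; exact: psdmx_unit_box.
pose reZ (A : {set 'I_n}) (rho : 'M[R]_(2 ^ n)) := complex.Re (\tr (Zstr R A *m toC rho)).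
pose imZ (A : {set 'I_n}) (rho : 'M[R]_(2 ^ n)) := complex.Im (\tr (Zstr R A *m toC rho)).
have tl A a (B D : 'M[R]_(2 ^ n)) : \tr (Zstr R A *m toC (a *: B + D)) =
    a%:C * \tr (Zstr R A *m toC B) + \tr (Zstr R A *m toC D).
  rewrite /toC map_mxD map_mxZ mulmxDr -scalemxAr mxtraceD mxtraceZ //.
have cre A : continuous (reZ A).
  apply: linear_functional_continuous => a B D; rewrite /reZ tl.
  by case: (\tr _) => x y; case: (\tr _) => x' y' /=; rewrite mul0r subr0.
have cim A : continuous (imZ A).
  apply: linear_functional_continuous => a B D; rewrite /imZ tl.
  by case: (\tr _) => x y; case: (\tr _) => x' y' /=; rewrite mul0r addr0.
have -> : GW_feasible S eps =
  ((\bigcap_(i in [set: 'I_(2 ^ n)]) \bigcap_(j in [set: 'I_(2 ^ n)])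
      [set rho : 'M[R]_(2 ^ n) | rho j i - rho i j = 0]) `&`
   (\bigcap_(v in [set: 'cV[R]_(2 ^ n)])
      [set rho : 'M[R]_(2 ^ n) | 0%R <= (v^T *m rho *m v) 0 0]) `&`
   [set rho : 'M[R]_(2 ^ n) | \tr rho = 1] `&`
   (\bigcap_(A in S) [set rho : 'M[R]_(2 ^ n) |
      (Num.sqrt (reZ A rho ^+ 2 + imZ A rho ^+ 2) <= eps)%R]))%classic.
  apply/seteqP; split => rho /=.
    move=> [sym psd tr1 hS]; split; [split; [split|]|] => //.
    - by move=> i _ j _ /=; rewrite -[in X in X - _]sym mxE subrr.
    - by move=> v _; exact: psd.
    by move=> A SA /=; have := hS A SA; rewrite normc_def lecR.
  move=> [[[sym psd] tr1] hS]; split => //.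
  - apply/matrixP => i j; rewrite mxE; apply/eqP; rewrite -subr_eq0; apply/eqP.
    exact: (sym i I j I).
  - by move=> v; exact: (psd v I).
  - by move=> A SA; have := hS A SA; rewrite normc_def lecR.
have clo (T : topologicalType) (f : T -> R) D :
    continuous f -> closed D -> closed (f @^-1` D)%classic.
  by move=> cf; move/continuous_closedP : cf; apply.
apply: closedI; [apply: closedI; [apply: closedI|]|].
- apply: closed_bigI => i _; apply: closed_bigI => j _.
  apply: (clo _ (fun rho : 'M[R]_(2 ^ n) => rho j i - rho i j) _ _ (@closed_eq R _)).
  by move=> A; apply: continuousB; exact: coord_continuous.
- apply: closed_bigI => v _.
  apply: (clo _ (fun rho : 'M[R]_(2 ^ n) => (v^T *m rho *m v) 0 0) _ _ (@closed_ge R _)).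
  apply: linear_functional_continuous => a A B.
  by rewrite mulmxDr mulmxDl -scalemxAr -scalemxAl mxE [X in X + _]mxE.
- apply: (clo _ (fun rho : 'M[R]_(2 ^ n) => \tr rho) _ _ (@closed_eq R _)).
  by apply: linear_functional_continuous => a A B; rewrite mxtraceD mxtraceZ.
- apply: closed_bigI => A _.
  apply: (clo _ (fun rho => Num.sqrt (reZ A rho ^+ 2 + imZ A rho ^+ 2)) _ _ (@closed_le R _)).
  have cs : continuous (fun rho => reZ A rho * reZ A rho + imZ A rho * imZ A rho).
    move=> rho; apply: (@continuousD R R _ (fun rho => reZ A rho * reZ A rho) (fun rho => imZ A rho * imZ A rho) rho);
      apply: continuousM; (exact: cre || exact: cim).
  move=> rho.
  exact: (continuous_comp (cs rho) (@sqrt_continuous R _)).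
Qed.

Lemma GW_feasible_nonempty (R : realType) n (S : set {set 'I_n}) (eps : R) :
  0 <= eps -> (S `<=` @nonempty_subsets n)%classic ->
  (GW_feasible S eps !=set0)%classic.
Proof.
move=> eps0 SS.
have N0 : (2 ^ n)%:R != 0 :> R by rewrite pnatr_eq0 -lt0n expn_gt0.
exists ((2 ^ n)%:R^-1)%:M; split.
- exact: tr_scalar_mx.
- move=> v; rewrite mul_mx_scalar -scalemxAl mxE mulr_ge0 ?invr_ge0 ?ler0n //.
  by rewrite mxE sumr_ge0 // => i _; rewrite mxE -expr2 sqr_ge0.
- by rewrite mxtrace_scalar -[_ *+ _]mulr_natr mulVf.
- move=> A /SS /= A0.
  rewrite /toC map_scalar_mx mul_mx_scalar mxtraceZ mxtrace_Zstr // mulr0 normr0.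
  by rewrite lecR.
Qed.

Lemma GW_max (R : realType) n (C : 'M[R]_(2 ^ n)) (S : set {set 'I_n}) (eps : R) :
  0 <= eps -> (S `<=` @nonempty_subsets n)%classic ->
  exists2 rho, GW_feasible S eps rho /\ GW_objective C rho = GW C S eps &
    forall rho', GW_feasible S eps rho' -> GW_objective C rho' <= GW_objective C rho.
Proof.
move=> eps0 SS.
have cobj : continuous (GW_objective C).
  apply: linear_functional_continuous => a A B.
  by rewrite /GW_objective mulmxDr -scalemxAr mxtraceD mxtraceZ.
have [rho rhoF rhomax] := compact_EVT_max (GW_feasible_nonempty eps0 SS)
  (@GW_feasible_compact R n S eps) (continuous_subspaceT cobj).
rewrite inE in rhoF.
have rhomax' rho' : GW_feasible S eps rho' -> GW_objective C rho' <= GW_objective C rho.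
  by move=> rhoF'; apply: rhomax; rewrite inE.
exists rho => //; split => //; apply/eqP; rewrite eq_le; apply/andP; split.
  apply: ub_le_sup; last by exists rho.
  by exists (GW_objective C rho) => _ [rho' rhoF' <-]; exact: rhomax'.
apply: ge_sup; first by exists (GW_objective C rho), rho.
by move=> _ [rho' rhoF' <-]; exact: rhomax'.
Qed.

(* Main.v *)
(** Twirling: if a Pauli string P commutes with C and anticommutes with Z_A, then
    replacing rho by (rho + P rho P^T) / 2 keeps the objective, makes
    tr(Z_A rho) vanish and multiplies every other tr(Z_B rho) by 0 or 1.
    Such a P exists for each Z_A outside the diagonal group, by double
    annihilators for the symplectic form on F_2^(2n).  Conversely, a Z_A in the
    F_2-span of the support of C is a product of support strings up to a sign,
    and not merely up to a power of i: C is real symmetric, so each of these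
    strings has an even number of factors Y and is a real matrix. *)

Require Import Defs.
From HB Require Import structures.
From mathcomp Require Import all_boot all_order all_algebra.
From mathcomp Require Import all_classical all_reals all_analysis.
From mathcomp Require Import complex mxtens ring.

Set Implicit Arguments.
Unset Strict Implicit.
Unset Printing Implicit Defensive.

Import Order.TTheory GRing.Theory Num.Theory.
Local Open Scope ring_scope.
Local Open Scope complex_scope.

(** * Algebra of tensor products of 2 x 2 matrices *)

Section BigTens.
Variable K : comPzRingType.

Lemma eq_bigtensmx n (A B : 'I_n -> 'M[K]_2) :
  A =1 B -> bigtensmx A = bigtensmx B.
Proof. by move=> /funext ->. Qed.

Lemma bigtensmx1 n : bigtensmx (fun _ : 'I_n => 1%:M : 'M[K]_2) = 1%:M.
Proof.
elim: n => [//|n IH] /=; rewrite IH.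
have -> : (1%:M : 'M[K]_2) *t (1%:M : 'M[K]_(2 ^ n)) = 1%:M.
  apply/matrixP => i j; case: (mxtens_indexP i) => i0 i1.
  case: (mxtens_indexP j) => j0 j1; rewrite tensmxE !mxE -natrM mulnb.
  by rewrite (inj_eq (can_inj (@mxtens_indexK _ _))).
by case: _ / (esym _).
Qed.

Lemma bigtensmxZ n (a : 'I_n -> K) (A : 'I_n -> 'M[K]_2) :
  bigtensmx (fun j => a j *: A j) = (\prod_j a j) *: bigtensmx A.
Proof.
elim: n a A => [|n IH] a A /=; first by rewrite big_ord0 scale1r.
rewrite big_ord_recl IH.
have -> (b d : K) (B : 'M[K]_2) (D : 'M[K]_(2 ^ n)) :
    (b *: B) *t (d *: D) = (b * d) *: (B *t D).
  by apply/matrixP => i j; rewrite !mxE mulrACA.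
by case: _ / (esym _).
Qed.

Lemma trmx_bigtensmx n (A : 'I_n -> 'M[K]_2) :
  (bigtensmx A)^T = bigtensmx (fun j => (A j)^T).
Proof.
elim: n A => [|n IH] A /=; first exact: trmx1.
rewrite -IH -trmx_tens.
by case: _ / (esym _).
Qed.

Lemma map_bigtensmx (L : comPzRingType) (f : {rmorphism K -> L}) n
    (A : 'I_n -> 'M[K]_2) :
  map_mx f (bigtensmx A) = bigtensmx (fun j => map_mx f (A j)).
Proof.
elim: n A => [|n IH] A /=; first exact: map_mx1.
rewrite -IH -map_mxT map_castmx //.
Qed.

End BigTens.

(** * Pauli strings stripped of their phases *)

Lemma mulmx2E (K : pzRingType) (M N : 'M[K]_2) i j :
  (M *m N) i j = M i 0 * N 0 j + M i 1 * N 1 j.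
Proof.
rewrite mxE !big_ord_recl big_ord0 addr0.
by congr (_ * _ + M _ _ * N _ _); apply: val_inj.
Qed.

Lemma matrix2P (K : pzRingType) (M N : 'M[K]_2) :
  M 0 0 = N 0 0 -> M 0 1 = N 0 1 -> M 1 0 = N 1 0 -> M 1 1 = N 1 1 -> M = N.
Proof.
move=> h00 h01 h10 h11; apply/matrixP => i j.
have o2 (k : 'I_2) : k = 0 \/ k = 1.
  by case: k => [[|[|]]] // h; [left|right]; apply: val_inj.
by case: (o2 i) => ->; case: (o2 j) => ->.
Qed.

(** Dropping the power of ['i] gives a matrix over any commutative ring, so that conjugation by a
    string stays within real matrices. *)
Definition xz_mx (K : comPzRingType) (a b : bool) : 'M[K]_2 :=
  pauliX K ^+ a *m pauliZ K ^+ b.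

Lemma xz_mxM (K : comPzRingType) a b c d :
  xz_mx K a b *m xz_mx K c d = (-1) ^+ (b * c) *: xz_mx K (a (+) c) (b (+) d).
Proof.
by case: a b c d => [] [] [] []; apply: matrix2P;
   rewrite /xz_mx !(expr0, expr1) /= !(mulmx2E, mxE) /=; ring.
Qed.

Lemma trmx_xz_mx (K : comPzRingType) a b :
  (xz_mx K a b)^T = (-1) ^+ (a * b) *: xz_mx K a b.
Proof.
by case: a b => [] []; apply: matrix2P;
   rewrite /xz_mx !(expr0, expr1) /= !(mulmx2E, mxE) /=; ring.
Qed.

Lemma map_xz_mx (K L : comPzRingType) (f : {rmorphism K -> L}) a b :
  map_mx f (xz_mx K a b) = xz_mx L a b.
Proof.
by case: a b => [] []; apply: matrix2P;
   rewrite /xz_mx !(expr0, expr1) /= !(mulmx2E, mxE) /= ?(mulmx2E, mxE) /=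
     ?(rmorphD, rmorphM, rmorphN, rmorph0, rmorph1, rmorphXn, rmorphMn) /=.
Qed.

Definition xorp n (p q : pauli_index n) : pauli_index n :=
  ([ffun j => p.1 j (+) q.1 j], [ffun j => p.2 j (+) q.2 j]).

Definition dotxz n (p q : pauli_index n) : nat := \sum_j p.1 j * q.2 j.

(** Only the parity matters: it is the symplectic form on F_2^(2n). Natural number values let it
    serve directly as an exponent of -1. *)
Definition symplp n (p q : pauli_index n) : nat := (dotxz p q + dotxz q p)%N.

Definition xzstr (K : comPzRingType) n (p : pauli_index n) : 'M[K]_(2 ^ n) :=
  bigtensmx (fun j => xz_mx K (p.1 j) (p.2 j)).

Section XZStrings.
Variables (K : comPzRingType) (n : nat).
Implicit Types p q : pauli_index n.

Lemma xorpC p q : xorp p q = xorp q p.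
Proof. by congr (_, _); apply/ffunP => j; rewrite !ffunE addbC. Qed.

Lemma xorpp p : xorp p p = Zindex finset.set0.
Proof. by congr (_, _); apply/ffunP => j; rewrite !ffunE addbb ?inE. Qed.

Lemma xzstr1 : xzstr K (Zindex (finset.set0 : {set 'I_n})) = 1%:M.
Proof.
rewrite -bigtensmx1; apply: eq_bigtensmx => j.
by rewrite /= !ffunE inE /xz_mx !expr0 mul1mx.
Qed.

Lemma xzstrM p q :
  xzstr K p *m xzstr K q = (-1) ^+ dotxz q p *: xzstr K (xorp p q).
Proof.
rewrite bigtensmx_mul -prodrXr -bigtensmxZ; apply: eq_bigtensmx => j.
by rewrite xz_mxM !ffunE mulnC.
Qed.

Lemma trmx_xzstr p : (xzstr K p)^T = (-1) ^+ dotxz p p *: xzstr K p.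
Proof.
rewrite trmx_bigtensmx -prodrXr -bigtensmxZ; apply: eq_bigtensmx => j.
exact: trmx_xz_mx.
Qed.

Lemma xzstr_comm p q :
  xzstr K p *m xzstr K q = (-1) ^+ symplp p q *: (xzstr K q *m xzstr K p).
Proof.
rewrite !xzstrM (xorpC q) scalerA exprD mulrAC -exprMn mulrNN mul1r expr1n.
by rewrite mul1r.
Qed.

(** The sign from the transpose and the sign from squaring the string are both [(-1) ^+ dotxz p p],
    so they cancel. *)
Lemma xzstr_tr_mul p : (xzstr K p)^T *m xzstr K p = 1%:M.
Proof.
rewrite trmx_xzstr -scalemxAl xzstrM scalerA -exprMn mulrNN mul1r.
by rewrite expr1n scale1r xorpp xzstr1.
Qed.

Lemma xzstr_conj w p :
  (xzstr K w)^T *m xzstr K p *m xzstr K w = (-1) ^+ symplp p w *: xzstr K p.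
Proof.
by rewrite -mulmxA xzstr_comm -scalemxAr mulmxA xzstr_tr_mul mul1mx.
Qed.

End XZStrings.

(** * Complex Pauli strings, their traces and expansions *)

Lemma toC_xzstr (R : realType) n (p : pauli_index n) :
  toC (xzstr R p) = xzstr R[i] p.
Proof. by rewrite /toC map_bigtensmx; apply: eq_bigtensmx => j; exact: map_xz_mx. Qed.

Lemma pauliE (R : realType) n (p : pauli_index n) :
  pauli R p = 'i ^+ dotxz p p *: toC (xzstr R p).
Proof. by rewrite toC_xzstr -prodrXr -bigtensmxZ. Qed.

Lemma trmx_pauli (R : realType) n (p : pauli_index n) :
  (pauli R p)^T = (-1) ^+ dotxz p p *: pauli R p.
Proof.
rewrite pauliE linearZ /= toC_xzstr trmx_xzstr !scalerA mulrC //.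
Qed.

Lemma dotxz_Zindex n (A : {set 'I_n}) : dotxz (Zindex A) (Zindex A) = 0%N.
Proof. by rewrite /dotxz big1 // => j _; rewrite /= ffunE. Qed.

Lemma ZstrE (R : realType) n (A : {set 'I_n}) :
  Zstr R A = toC (xzstr R (Zindex A)).
Proof. by rewrite /Zstr pauliE dotxz_Zindex expr0 scale1r. Qed.

Lemma mxtrace_Zstr_toC (R : realType) n (A : {set 'I_n}) (rho : 'M[R]_(2 ^ n)) :
  \tr (Zstr R A *m toC rho) = (\tr (xzstr R (Zindex A) *m rho))%:C.
Proof. by rewrite ZstrE /toC -map_mxM trace_map_mx. Qed.

(** Extending the coefficients by zero off the listed indices turns the given sum into one over all
    indices, as [pauli_support] requires. *)
Lemma pauli_expansion_sum (R : realType) n (C : 'M[R]_(2 ^ n)) M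
    (xz : 'I_M -> pauli_index n) (c : pauli_index n -> R) :
  injective xz -> toC C = \sum_(i < M) (c (xz i))%:C *: pauli R (xz i) ->
  pauli_expansion C (fun p => c p *+ (p \in codom xz)).
Proof.
move=> xz_inj eC; rewrite /pauli_expansion eC.
rewrite (bigID (mem (codom xz))) /= [X in _ + X]big1 ?addr0; last first.
  by move=> p /negPf ->; rewrite mulr0n scale0r.
rewrite -big_uniq; last by rewrite map_inj_uniq ?enum_uniq.
rewrite big_image; apply: eq_bigr => i _.
by rewrite codom_f mulr1n.
Qed.


(** * Linear algebra over F_2 *)

Section Symplectic.
Variable n : nat.
Implicit Types p q : pauli_index n.

Definition F2vec p : 'rV['F_2]_(n + n) :=
  row_mx (\row_j (p.1 j)%:R) (\row_j (p.2 j)%:R).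

Lemma natF2_eq0 m : (m%:R == 0 :> 'F_2) = ~~ odd m.
Proof. by rewrite -(dvdn_pcharf (pchar_Fp (isT : prime 2))) dvdn2. Qed.

Lemma F2_natE (x : 'F_2) : x = (x != 0)%:R.
Proof. by case: x => [[|[|]]] // h; apply: val_inj. Qed.

Lemma F2vec_xorp p q : F2vec (xorp p q) = F2vec p + F2vec q.
Proof.
rewrite add_row_mx; congr row_mx; apply/rowP => j; rewrite !mxE ffunE;
  by case: (_ j); case: (_ j); apply: val_inj.
Qed.

Lemma F2vec_inj : injective F2vec.
Proof.
move=> [x z] [x' z'] /eq_row_mx[/rowP hx /rowP hz].
congr (_, _); apply/ffunP => j; [have := hx j | have := hz j]; rewrite !mxE /=;
  by case: (_ j); case: (_ j).
Qed.

(** The two halves of [k] are exchanged because the symplectic form pairs x with z. *)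
Definition dualp (k : 'cV['F_2]_(n + n)) : pauli_index n :=
  ([ffun j => k (rshift n j) 0 != 0], [ffun j => k (lshift n j) 0 != 0]).

Lemma F2vec_dual p k : (F2vec p *m k) 0 0 = (symplp p (dualp k))%:R.
Proof.
rewrite mxE big_split_ord /= natrD !natr_sum; congr (_ + _);
  apply: eq_bigr => j _; rewrite ?row_mxEl ?row_mxEr mxE natrM ffunE -F2_natE //.
by rewrite mulrC.
Qed.

(* Double annihilator: a vector outside the span is detected by a functional
   vanishing on the span, and every functional is a symplectic pairing. *)
Lemma symplectic_separation M (xz : 'I_M -> pauli_index n) p :
  (exists u : 'rV['F_2]_M, F2vec p = \sum_i u 0 i *: F2vec (xz i)) \/
  (exists w, (forall i, ~~ odd (symplp (xz i) w)) /\ odd (symplp p w)).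
Proof.
pose B := \matrix_i F2vec (xz i).
have [/submxP[u pu]|] := boolP (F2vec p <= B)%MS.
  left; exists u; rewrite pu mulmx_sum_row; apply: eq_bigr => i _.
  by rewrite rowK.
rewrite submxE => /matrix0Pn[i0 [k pk]]; right.
(* The columns of [cokermx B] vanish on every row of [B]; column [k] is one that does not vanish on
   [F2vec p]. *)
exists (dualp (col k (cokermx B))); split => [i|].
  rewrite -natF2_eq0 -F2vec_dual colE mulmxA -colE.
  have -> : F2vec (xz i) = row i B by rewrite rowK.
  by rewrite -row_mul mulmx_coker !mxE.
by rewrite -[odd _]negbK -natF2_eq0 -F2vec_dual colE mulmxA -colE mxE -(ord1 i0).
Qed.

End Symplectic.

(** * The span of the support lies in the diagonal group *)

(* [pauli R p] is symmetric or antisymmetric according to the parity of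
   [dotxz p p], its number of factors Y. *)
Lemma pauli_support_even (R : realType) n (C : 'M[R]_(2 ^ n)) p :
  C^T = C -> pauli_support C p -> ~~ odd (dotxz p p).
Proof.
move=> symC [c ec cp].
(* Transposing the expansion of the symmetric [C] yields a second expansion; by uniqueness, an odd
   [dotxz p p] would give [c p = - c p]. *)
have ec' : pauli_expansion C (fun p => (-1) ^+ dotxz p p * c p).
  rewrite /pauli_expansion -{1}symC /toC -matrix.map_trmx -/(toC C) {1}ec linear_sum /=.
  apply: eq_bigr => q _; rewrite linearZ /= trmx_pauli scalerA mulrC.
  by rewrite rmorphM rmorphXn rmorphN1.
have := pauli_expansion_uniq ec ec' p.
rewrite -signr_odd; case: (odd _) => //; rewrite expr1 mulN1r => /eqP.
by rewrite -addr_eq0 -mulr2n mulrn_eq0 (negPf cp).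
Qed.

Lemma pauli_even (R : realType) n (p : pauli_index n) :
  ~~ odd (dotxz p p) ->
  exists b : bool, pauli R p = (-1) ^+ b *: toC (xzstr R p).
Proof.
move=> /even_halfK e; rewrite pauliE -{1}e -mul2n exprM sqr_i -signr_odd.
by exists (odd (dotxz p p)./2).
Qed.

Lemma mem_diagonal_group (R : realType) n (C : 'M[R]_(2 ^ n)) M
    (xz : 'I_M -> pauli_index n) (A : {set 'I_n}) (u : 'rV['F_2]_M) :
  C^T = C -> (forall i, pauli_support C (xz i)) ->
  F2vec (Zindex A) = \sum_i u 0 i *: F2vec (xz i) -> diagonal_group C A.
Proof.
move=> symC xzC vA.
(* Vectors represented in the group by a real string up to sign. Leaving the sign free makes this
   set closed under addition, where products of strings create signs. *)
pose inG v := exists p, F2vec p = v /\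
  exists b : bool, pauli_group_of C ((-1) ^+ b *: toC (xzstr R p)).
have inG0 : inG 0.
  exists (Zindex finset.set0); split.
    (* The vector of the identity string equals its own double, hence is zero. *)
    have := F2vec_xorp (Zindex (@finset.set0 'I_n)) (Zindex finset.set0).
    by rewrite xorpp -{1}[F2vec _]addr0 => /addrI.
  exists false; rewrite expr0 scale1r toC_xzstr xzstr1; exact: gen_mx_1.
have inGD v w : inG v -> inG w -> inG (v + w).
  move=> [p [<- [b bp]]] [q [<- [d dq]]]; exists (xorp p q).
  split; first exact: F2vec_xorp.
  exists (b (+) d (+) odd (dotxz q p)); have := gen_mx_mul bp dq.
  rewrite -scalemxAl -scalemxAr scalerA -signr_addb !toC_xzstr xzstrM scalerA.
  by rewrite -(signr_odd _ (dotxz q p)) -signr_addb.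
have inGA : inG (F2vec (Zindex A)).
  rewrite vA; apply: (big_ind inG) => // i _.
  rewrite [u 0 i]F2_natE; case: (_ != 0); last by rewrite scale0r.
  rewrite scale1r; exists (xz i); split => //.
  have [b hb] := pauli_even R (pauli_support_even symC (xzC i)).
  by exists b; rewrite -hb; apply: gen_mx_in; exists (xz i).
have [p [/F2vec_inj -> [b]]] := inGA; rewrite -ZstrE.
by case: b; rewrite ?expr0 ?expr1 ?scaleN1r ?scale1r; [right|left].
Qed.

(** * Twirling by a single string *)

Section Twirl.
Variables (R : realType) (n : nat) (w : pauli_index n).
Implicit Types rho C : 'M[R]_(2 ^ n).

Definition twirl rho : 'M[R]_(2 ^ n) :=
  2^-1 *: (rho + xzstr R w *m rho *m (xzstr R w)^T).

(** Cyclicity of the trace moves the conjugation from the state onto the observable. *)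
Lemma mxtrace_mul_twirl D rho :
  \tr (D *m twirl rho) =
  2^-1 * (\tr (D *m rho) + \tr ((xzstr R w)^T *m D *m xzstr R w *m rho)).
Proof.
rewrite /twirl -scalemxAr mxtraceZ mulmxDr mxtraceD; congr (_ * (_ + _)).
by rewrite mulmxA mxtrace_mulC !mulmxA.
Qed.

Lemma mxtrace_comm_twirl D rho :
  D *m xzstr R w = xzstr R w *m D -> \tr (D *m twirl rho) = \tr (D *m rho).
Proof.
move=> Dw; rewrite mxtrace_mul_twirl -(mulmxA _ D) Dw mulmxA xzstr_tr_mul mul1mx.
by rewrite -mulr2n -[X in _ * X]mulr_natl mulKf // pnatr_eq0.
Qed.

(** Conjugation multiplies the string by a sign, so averaging either keeps its trace or cancels
    it. *)
Lemma mxtrace_xzstr_twirl p rho :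
  \tr (xzstr R p *m twirl rho) =
  \tr (xzstr R p *m rho) *+ ~~ odd (symplp p w).
Proof.
rewrite mxtrace_mul_twirl xzstr_conj -scalemxAl mxtraceZ -signr_odd.
by case: (odd _); rewrite ?expr0 ?expr1 ?mulr0n ?mulr1n; field.
Qed.

Lemma psdmx_twirl rho : psdmx rho -> psdmx (twirl rho).
Proof.
move=> psd v; rewrite /twirl -scalemxAr -scalemxAl mxE mulr_ge0 ?invr_ge0 ?ler0n //.
rewrite mulmxDr mulmxDl mxE addr_ge0 //.
(* The conjugated term is the quadratic form of [rho] at a transformed vector. *)
have := psd ((xzstr R w)^T *m v); rewrite trmx_mul trmxK !mulmxA //.
Qed.

Lemma twirl_feasible S eps rho :
  GW_feasible S eps rho -> GW_feasible S eps (twirl rho).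
Proof.
move=> [sym psd tr1 hS]; split.
- by rewrite /twirl linearZ linearD /= !trmx_mul trmxK sym mulmxA.
- exact: psdmx_twirl.
- by rewrite -(mul1mx (twirl _)) mxtrace_comm_twirl ?mul1mx ?mulmx1.
- move=> A /hS; rewrite !mxtrace_Zstr_toC mxtrace_xzstr_twirl.
  (* For a cancelled trace, [0 <= eps] follows from the bound already known for [rho]. *)
  by case: (~~ _); rewrite ?mulr1n // mulr0n normr0; apply: le_trans.
Qed.

End Twirl.

(** * Twirling over all subsets and equality of the two values *)

Lemma xzstr_comm_mx (R : realType) n (C : 'M[R]_(2 ^ n)) M
    (xz : 'I_M -> pauli_index n) (a : 'I_M -> R[i]) w :
  toC C = \sum_i a i *: pauli R (xz i) ->
  (forall i, ~~ odd (symplp (xz i) w)) ->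
  C *m xzstr R w = xzstr R w *m C.
Proof.
move=> eC comm_w; apply: (@map_mx_inj _ _ (real_complex R)).
rewrite !map_mxM -/(toC C) -/(toC (xzstr R w)) eC mulmx_suml mulmx_sumr.
apply: eq_bigr => i _; rewrite -scalemxAl -scalemxAr pauliE; congr (_ *: _).
rewrite -scalemxAl -scalemxAr !toC_xzstr xzstr_comm -signr_odd.
by rewrite (negPf (comm_w i)) expr0 scale1r.
Qed.

(** Subsets are treated one at a time, twirling for each nonempty one not in [S]. A twirl never
    increases any [|tr(Z_B rho)|], so bounds obtained earlier survive. *)
Lemma GW_feasible_extend (R : realType) n (C rho : 'M[R]_(2 ^ n)) (S : set {set 'I_n}) eps :
  0 <= eps ->
  (forall A, A != finset.set0 -> S A \/ exists w, C *m xzstr R w = xzstr R w *m C /\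
                              odd (symplp (Zindex A) w)) ->
  GW_feasible S eps rho ->
  exists2 rho', GW_feasible (@nonempty_subsets n) eps rho' &
    GW_objective C rho' = GW_objective C rho.
Proof.
move=> eps0 sep rhoS.
(* Restricting the bounds to a list allows induction on it; feasibility for [S] is carried along to
   supply the bounds for members of [S]. *)
suff [rho' [rhoF hT] obj] : exists2 rho', GW_feasible S eps rho' /\
    (forall A, A \in enum {set 'I_n} -> A != finset.set0 ->
      `|\tr (Zstr R A *m toC rho')| <= eps%:C) &
    GW_objective C rho' = GW_objective C rho.
  exists rho' => //; case: rhoF => sym psd tr1 _; split => // A A0.
  by apply: hT; rewrite ?mem_enum.
elim: (enum _) => [|A s [rho1 [rho1S hs] obj]]; first by exists rho.
have [->|A0] := eqVneq A finset.set0.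
  exists rho1 => //; split => // B; rewrite inE => /orP[/eqP -> |]; last exact: hs.
  by rewrite eqxx.
have [SA|[w [Cw Aw]]] := sep A A0.
  exists rho1 => //; split => // B; rewrite inE => /orP[/eqP -> _|]; last exact: hs.
  by case: rho1S => _ _ _; apply.
exists (twirl w rho1).
  split; first exact: twirl_feasible.
  move=> B; rewrite inE mxtrace_Zstr_toC mxtrace_xzstr_twirl => /orP[/eqP -> _|Bs B0].
    by rewrite Aw mulr0n normr0 lecR.
  have := hs B Bs B0; rewrite mxtrace_Zstr_toC; case: (~~ _); rewrite ?mulr1n // mulr0n normr0.
  exact: le_trans.
rewrite -obj /GW_objective mxtrace_comm_twirl //.
by rewrite -scalemxAl -scalemxAr Cw.
Qed.

Lemma GW_feasible_subset (R : realType) n (S S' : set {set 'I_n}) (eps : R) rho :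
  (S `<=` S')%classic -> GW_feasible S' eps rho -> GW_feasible S eps rho.
Proof. by move=> SS' [sym psd tr1 hS']; split => // A /SS'; exact: hS'. Qed.

Theorem proposition14 (R : realType) (n : nat) (C : 'M[R]_(2 ^ n))
    (M : nat) (xz : 'I_M -> pauli_index n) (c : pauli_index n -> R) (eps : R) :
  (1 <= n)%N ->
  C^T = C ->
  C != 0 ->
  injective xz ->
  (forall i : 'I_M, c (xz i) != 0) ->
  toC C = \sum_(i < M) (c (xz i))%:C *: pauli R (xz i) ->
  0 <= eps ->
  GW C (diagonal_group_dot C) eps = GW C (@nonempty_subsets n) eps.
Proof.
move=> _ symC _ xz_inj cxz eC eps0.
have sub : (diagonal_group_dot C `<=` @nonempty_subsets n)%classic by move=> A [].
have xzC i : pauli_support C (xz i).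
  exists (fun p => c p *+ (p \in codom xz)); first exact: pauli_expansion_sum.
  by rewrite codom_f mulr1n.
(* Both suprema are attained, so it suffices to compare maximizers. *)
have [rho [rhoF <-] rho_max] := GW_max C eps0 sub.
have [tau [tauF <-] tau_max] := GW_max C eps0 (@subset_refl _ (@nonempty_subsets n)).
(* Fewer constraints can only raise the maximum; the other inequality needs the twirl. *)
apply/eqP; rewrite eq_le rho_max ?andbT; last exact: GW_feasible_subset tauF.
have sep A : A != finset.set0 -> diagonal_group_dot C A \/
    exists w, C *m xzstr R w = xzstr R w *m C /\ odd (symplp (Zindex A) w).
  move=> A0; have [[u vA]|[w [xzw Aw]]] := symplectic_separation xz (Zindex A).
    by left; split => //; exact: mem_diagonal_group vA.
  by right; exists w; split => //; exact: xzstr_comm_mx eC xzw.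
have [rho' rho'F <-] := GW_feasible_extend eps0 sep rhoF.
exact: tau_max.
Qed.
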